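(* Let $\theta\in(0,1)$. There exist constants $C_h(\theta)>0$ and $C_\epsilon(\theta)>0$ depending only on $\theta$ such that the following holds. If the time step $\Delta t>0$ satisfies $$\Delta t<C_{\Delta t}:=\frac1{\nu\lambda_1}\min\Big\{\frac{8\theta(1-\theta^2)}{8-6\theta^2+3\theta^4},\,2(1-\theta)\Big\},$$ then there exist $\epsilon>0$, $a,b,c\in\mathbb{R}$ and a positive definite block-diagonal matrix $H(\theta)=\mathrm{diag}(h_{11}(\theta)\mathbb{I},h_{22}(\theta)\mathbb{I})$ such that, for the velocity approximations $(u_n)_{n\ge0}$ of the fully implicit DLN scheme and every $n\ge1$, $$\left\|\begin{matrix}u_{n+1}\\ u_n\end{matrix}\right\|_{G(\theta)}^2-\left\|\begin{matrix}u_n\\ u_{n-1}\end{matrix}\right\|_{G(\theta)}^2+\Big\|\sum_{\ell=0}^2a_\ell u_{n-1+\ell}\Big\|^2+\frac{\nu\Delta t\,\lambda_1}{2}\|u_{n,\beta}\|^2$$ $$=(1+\epsilon)\left\|\begin{matrix}u_{n+1}\\ u_n\end{matrix}\right\|_{H(\theta)}^2-\left\|\begin{matrix}u_n\\ u_{n-1}\end{matrix}\right\|_{H(\theta)}^2+\|a u_{n+1}+bu_n+cu_{n-1}\|^2,$$ where $\left\|\begin{matrix}u\\ v\end{matrix}\right\|_{H(\theta)}^2=h_{11}(\theta)\|u\|^2+h_{22}(\theta)\|v\|^2$. Moreover $$h_{11}(\theta)>\frac{\theta^3}{2}\Big[1-\frac12\theta(1-\theta)\Big]>0,\qquad h_{22}(\theta)>\frac1{16}\theta(1-\theta)^2(1+\theta)(2+\theta)>0,$$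 $$\max\{h_{11}(\theta),h_{22}(\theta)\}<C_h(\theta),\qquad \frac14<\frac1\epsilon<\frac{C_\epsilon(\theta)}{\nu\lambda_1\Delta t}.$$
   Context: Setting. $\Omega\subset\mathbb{R}^2$ is a domain with boundary of class $C^2$, $\nu>0$, $(\cdot,\cdot)$ and $\|\cdot\|$ are the $L^2(\Omega)$ inner product and norm. $H=\{v\in L^2(\Omega)^2:\nabla\cdot v=0,\ v\cdot\vec n|_{\partial\Omega}=0\}$, $V=\{v\in H_0^1(\Omega)^2:\nabla\cdot v=0\}$. $f\in L^\infty(\mathbb{R}_+;H)$. The Stokes operator $A:V\to V'$ is $\langle Au,v\rangle=(\nabla u,\nabla v)$; $\lambda_1>0$ is its smallest eigenvalue. $b(u,v,w)=(u\cdot\nabla v,w)$. DLN coefficients: $\alpha_2=\frac{\theta+1}{2}$, $\alpha_1=-\theta$, $\alpha_0=\frac{\theta-1}{2}$; $\beta_2=\frac{2+\theta-\theta^2}{4}$, $\beta_1=\frac{\theta^2}{2}$, $\beta_0=\frac{2-\theta-\theta^2}{4}$. For a sequence $(z_n)$, $z_{n,\beta}=\sum_{\ell=0}^2\beta_\ell z_{n-1+\ell}$; $t_n=n\Delta t$. DLN scheme: given $u_0,u_1\in V$, for $n\ge1$, $u_{n+1}\in V$ satisfies, for all $v\in V$, $\frac1{\Delta t}\big(\sum_{\ell=0}^2\alpha_\ell u_{n-1+\ell},v\big)+\nu(\nabla u_{n,\beta},\nabla v)+b(u_{n,\beta},u_{n,\beta},v)=(f(t_{n,\beta}),v)$. $G$-norm: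 $\left\|\begin{matrix}u\\ v\end{matrix}\right\|_{G(\theta)}^2=\frac{1+\theta}{4}\|u\|^2+\frac{1-\theta}{4}\|v\|^2$. Dissipation coefficients: $a_1=-\sqrt{\theta(1-\theta^2)/2}$, $a_2=a_0=-\frac12a_1$. The quantities $\epsilon,a,b,c,h_{11},h_{22}$ may depend on $\theta$ and on $\nu\lambda_1\Delta t$, but not on $n$. *)

(* Defs.v *)
From HB Require Import structures.
From mathcomp Require Import all_boot all_order all_algebra.
From mathcomp Require Import all_classical all_reals all_analysis.
Set Implicit Arguments.
Unset Strict Implicit.
Unset Printing Implicit Defensive.
Import Order.TTheory GRing.Theory Num.Theory.
Import numFieldNormedType.Exports.
Local Open Scope classical_set_scope.
Local Open Scope ring_scope.

(* The plane is R * R.  Elements of L^2, H and V are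
   represented by functions on the whole plane, of which only the restriction
   to Omega matters; equality in these spaces is equality a.e. on Omega. *)
Notation vfield R := ('I_2 -> (R * R)%type -> R) (only parsing).

Section FunctionSpaces.
Variable R : realType.
Implicit Types (Omega : set (R * R)) (p q g phi : R * R -> R).
Implicit Types (u v w : vfield R) (i j : 'I_2).

Definition mu2 := (@lebesgue_measure R \x @lebesgue_measure R)%E.

Definition basis2 i : R * R := ((i == 0)%:R, (i == 1)%:R).

Definition domain Omega := [/\ open Omega, connected Omega & Omega !=set0].

Definition C2_fun (gam : R -> R) :=
  [/\ forall x, derivable gam x 1,
      forall x, derivable (derive1 gam) x 1 &
      continuous (derive1n 2 gam)].

(* Near each boundary point z, and in the orthonormal frame (c, s), (- s, c)
   centred at z, Omega is the strict epigraph of a C^2 function. *)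
Definition C2_boundary Omega :=
  forall z, (closure Omega `\` interior Omega) z ->
  exists (c s : R) (gam : R -> R),
    [/\ c ^+ 2 + s ^+ 2 = 1, C2_fun gam &
        \forall y \near z,
          Omega y <-> gam (c * (y.1 - z.1) + s * (y.2 - z.2))
                      < c * (y.2 - z.2) - s * (y.1 - z.1)].

Definition pderiv i p : R * R -> R := fun x => 'D_(basis2 i) p x.

Definition smooth p := forall s : seq 'I_2,
  let ps : R * R -> R := foldr pderiv p s in
  continuous ps /\ forall i x, derivable ps x (basis2 i).

Definition test_fun Omega phi := smooth phi /\
  exists K : set (R * R),
    [/\ compact K, K `<=` Omega & forall x, ~ K x -> phi x = 0].

Definition L2 Omega p := (p \_ Omega) \in Lfun mu2 2%:E.

Definition ip0 Omega p q : R := \int[mu2]_(x in Omega) (p x * q x).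

Definition is_wderiv Omega i p g := L2 Omega g /\
  forall phi, test_fun Omega phi -> ip0 Omega p (pderiv i phi) = - ip0 Omega g phi.

Definition H1 Omega p :=
  L2 Omega p /\ forall i, exists g, is_wderiv Omega i p g.

(* A representative of the weak derivative (0 if there is none). *)
Definition wderiv Omega i p : R * R -> R := xget 0 [set g | is_wderiv Omega i p g].

(* Closure of C_c^oo(Omega) in H^1(Omega). *)
Definition H10 Omega p := H1 Omega p /\
  exists phi : nat -> R * R -> R,
  [/\ forall k, test_fun Omega (phi k),
      (fun k => ip0 Omega (phi k - p) (phi k - p)) @ \oo --> (0 : R) &
      forall i, (fun k => ip0 Omega (pderiv i (phi k) - wderiv Omega i p)
                                    (pderiv i (phi k) - wderiv Omega i p))
                @ \oo --> (0 : R)].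

Definition ip Omega u v : R := \sum_(i < 2) ip0 Omega (u i) (v i).
Definition L2norm Omega u : R := Num.sqrt (ip Omega u u).

Definition gradip Omega u v : R :=
  \sum_(i < 2) \sum_(j < 2)
    ip0 Omega (wderiv Omega i (u j)) (wderiv Omega i (v j)).

Definition convect Omega u v : vfield R :=
  fun j x => \sum_(i < 2) u i x * wderiv Omega i (v j) x.

Definition trilin Omega u v w : R := ip Omega (convect Omega u v) w.

(* div v = 0 in the sense of distributions on Omega. *)
Definition div_free Omega v := forall phi, test_fun Omega phi ->
  ip Omega v (fun i => pderiv i phi) = 0.

(* For a divergence-free v in L^2(Omega)^2, the normal trace v.n is the
   functional q |-> (v, grad q) + (div v, q) = (v, grad q) on H^1(Omega). *)
Definition normal_trace0 Omega v := forall q, H1 Omega q ->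
  ip Omega v (fun i => wderiv Omega i q) = 0.

Definition spaceH Omega v :=
  [/\ forall i, L2 Omega (v i), div_free Omega v & normal_trace0 Omega v].

Definition spaceV Omega v := (forall i, H10 Omega (v i)) /\ div_free Omega v.

(* The Stokes operator A : V -> V', as the functional A u on V. *)
Definition stokes Omega u : vfield R -> R := fun v => gradip Omega u v.

Definition stokes_eigenvalue Omega (lam : R) := exists w,
  [/\ spaceV Omega w, L2norm Omega w != 0 &
      forall v, spaceV Omega v -> stokes Omega w v = lam * ip Omega w v].

Definition smallest_stokes_eigenvalue Omega (lam1 : R) :=
  stokes_eigenvalue Omega lam1 /\
  forall lam, stokes_eigenvalue Omega lam -> lam1 <= lam.

Definition simple_H Omega (s : R -> vfield R) :=
  exists (m : nat) (E : 'I_m -> set R) (w : 'I_m -> vfield R),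
  [/\ forall k, measurable (E k), forall k, spaceH Omega (w k) &
      forall t, s t = \sum_(k < m) (\1_(E k) t : R) *: w k].

(* L^oo(R_+; H): strongly (Bochner) measurable and essentially bounded. *)
Definition Linfty_H Omega (f : R -> vfield R) :=
  [/\ forall t, 0 <= t -> spaceH Omega (f t),
      exists s : nat -> R -> vfield R,
        (forall k, simple_H Omega (s k)) /\
        {ae (@lebesgue_measure R), forall t, 0 <= t ->
          (fun k => L2norm Omega (s k t - f t)) @ \oo --> (0 : R)} &
      exists M : R, {ae (@lebesgue_measure R), forall t, 0 <= t ->
        L2norm Omega (f t) <= M}].

End FunctionSpaces.

Section DLN.
Variable R : realType.
Implicit Types (theta nu dt : R) (Omega : set (R * R)).

Definition DLN_alpha theta : 'I_3 -> R :=
  nth 0 [:: (theta - 1) / 2; - theta; (theta + 1) / 2].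

Definition DLN_beta theta : 'I_3 -> R :=
  nth 0 [:: (2 - theta - theta ^+ 2) / 4; theta ^+ 2 / 2;
            (2 + theta - theta ^+ 2) / 4].

Definition DLN_a1 theta : R := - Num.sqrt (theta * (1 - theta ^+ 2) / 2).

Definition DLN_a theta : 'I_3 -> R :=
  nth 0 [:: - (DLN_a1 theta / 2); DLN_a1 theta; - (DLN_a1 theta / 2)].

(* \sum_l c_l z_(n - 1 + l), used for 1 <= n only. *)
Definition comb3 (U : lmodType R) (c : 'I_3 -> R) (z : nat -> U) (n : nat) : U :=
  \sum_(l < 3) c l *: z (n.-1 + l)%N.

Definition DLN_time theta dt n : R :=
  comb3 (DLN_beta theta) (fun k => k%:R * dt : R^o) n.

Definition DLN_scheme theta Omega nu dt (f : R -> vfield R)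
    (u : nat -> vfield R) :=
  [/\ spaceV Omega (u 0%N), spaceV Omega (u 1%N) &
      forall n, (1 <= n)%N ->
        spaceV Omega (u n.+1) /\
        forall v, spaceV Omega v ->
          let ub := comb3 (DLN_beta theta) u n in
          dt^-1 * ip Omega (comb3 (DLN_alpha theta) u n) v
          + nu * gradip Omega ub v + trilin Omega ub ub v
          = ip Omega (f (DLN_time theta dt n)) v].

Definition diag_norm2 Omega (h1 h2 : R) (u v : vfield R) : R :=
  h1 * L2norm Omega u ^+ 2 + h2 * L2norm Omega v ^+ 2.

Definition G_norm2 theta Omega : vfield R -> vfield R -> R :=
  diag_norm2 Omega ((1 + theta) / 4) ((1 - theta) / 4).

(* diag(h1 I, h2 I) with I the identity of R^2. *)
Definition block_diag (h1 h2 : R) : 'M[R]_(2 + 2) :=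
  block_mx h1%:M 0 0 h2%:M.

Definition posdefmx (m : nat) (M : 'M[R]_m) :=
  M^T = M /\ forall x : 'cV[R]_m, x != 0 -> 0 < (x^T *m M *m x) 0 0.

End DLN.

(* Main.v *)
Require Import Defs.
From HB Require Import structures.
From mathcomp Require Import all_boot all_order all_algebra.
From mathcomp Require Import all_classical all_reals all_analysis.
From mathcomp Require Import ring lra.
Set Implicit Arguments.
Unset Strict Implicit.
Unset Printing Implicit Defensive.
Import Order.TTheory GRing.Theory Num.Theory.
Import numFieldNormedType.Exports.
Local Open Scope classical_set_scope.
Local Open Scope ring_scope.

(** The asserted identity is an identity between two quadratic forms in the
three vectors N = u_{n+1}, M = u_n, O = u_{n-1} of L^2, so it holds for
arbitrary square integrable fields once the six coefficients agree. The
velocities of the scheme enter only through their square integrability, which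
makes the norms expand into inner products ([L2norm_comb]).

Write k = nu * lam1 * dt and h = k / 4. On the right-hand side the weights
h11, h22 and eps do not meet the mixed products NM, NO, MO, so these three
coefficients determine the square |a N + b M + c O|^2 up to sign: from
2ab, 2ac, 2bc one gets a^2 = (2ab)(2ac) / (2 (2bc)) and cyclically. The
bound k < 2 (1 - theta) gives ab < 0, bc < 0 and ac > 0, so that these
quotients are positive and a, b, c are real. The three diagonal coefficients
that remain after removal of a^2, b^2, c^2 are called [res_new], - [res_mid]
and - [res_old] and have to equal (1 + eps) h11, (1 + eps) h22 - h11 and
- h22. Hence h22 = [res_old], h11 = [res_new] / g, and
g = 1 + eps must be the positive root of
  res_old * g^2 + res_mid * g = res_new.

Everything else is read off from this equation. In the equivalent form
h11 = g * res_old + res_mid, the claim g > 1 gives h11 > res_old + res_mid, and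
the two stated lower bounds are lower bounds on [res_mid] and [res_old]. The
equation is also equivalent to
  eps * (h11 + h22) = res_new - res_mid - res_old,
so the size of eps is that of the gap on the right. Evaluating the identity at
N = M = O gives gap = k / 2 - (a + b + c)^2, and (a + b + c)^2 is of order k^2:
the first bound on k makes it at most 9 / 10 of k / 2 ([square_defect]).
Therefore k / 20 <= gap <= k / 2; together with h11, h22 < 2 this gives
eps > k / 80, while eps < 4 follows from h11 + h22 > k / 8. *)

(** * Quadratic expansion of the L^2 norm *)

Section L2_expansion.
Variables (R : realType) (Omega : set (R * R)).
Implicit Types (p q s : R * R -> R) (u v w : vfield R).

(** [L2] speaks of the functions restricted to [Omega], hence integrability of
products is available for integrals over the whole plane. *)
Lemma ip0_restrict p q :
  ip0 Omega p q = \int[@mu2 R]_x ((p \_ Omega) x * (q \_ Omega) x).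
Proof.
rewrite /ip0 Rintegral_mkcond; apply: eq_Rintegral => x _.
by rewrite !patchE; case: ifPn => // _; rewrite mulr0.
Qed.

Lemma ip0C p q : ip0 Omega p q = ip0 Omega q p.
Proof. by apply: eq_Rintegral => x _; rewrite mulrC. Qed.

Lemma L2_mul_integrable p q : L2 Omega p -> L2 Omega q ->
  (@mu2 R).-integrable setT (EFin \o ((p \_ Omega) \* (q \_ Omega))).
Proof.
by move=> p2 q2; apply/Lfun1_integrable/Lfun2_mul_Lfun1.
Qed.

Lemma L2_lin (a : R) p q : L2 Omega p -> L2 Omega q -> L2 Omega (a *: p + q).
Proof.
rewrite /L2 => p2 q2.
have -> : (a *: p + q) \_ Omega = a *: (p \_ Omega) + q \_ Omega.
  apply/funext => x; rewrite !fctE /= !patchE.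
  by case: ifPn => // _; rewrite scaler0 addr0.
have le12 : (1 <= 2%:E :> \bar R)%E by rewrite lee_fin ler1n.
exact: (Lfun_submod_closed (@mu2 R) le12).2.
Qed.

Lemma ip0_lin (a : R) p q s : L2 Omega p -> L2 Omega q -> L2 Omega s ->
  ip0 Omega (a *: p + q) s = a * ip0 Omega p s + ip0 Omega q s.
Proof.
move=> p2 q2 s2; rewrite !ip0_restrict -RintegralZl//; last first.
  exact: L2_mul_integrable.
rewrite -RintegralD//; last 2 first.
- exact/(integrableZl _ _ (L2_mul_integrable p2 s2)).
- exact: L2_mul_integrable.
apply: eq_Rintegral => x _; rewrite !patchE !fctE /=.
by case: ifPn => _; rewrite ?mulr0 ?addr0// mulrDl mulrA.
Qed.

Definition L2_field u := forall i, L2 Omega (u i).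

Lemma ipC u v : ip Omega u v = ip Omega v u.
Proof. by apply: eq_bigr => i _; exact: ip0C. Qed.

Lemma L2_field_lin (a : R) u v :
  L2_field u -> L2_field v -> L2_field (a *: u + v).
Proof. by move=> u2 v2 i; exact: L2_lin. Qed.

Lemma ip_lin (a : R) u v w : L2_field u -> L2_field v -> L2_field w ->
  ip Omega (a *: u + v) w = a * ip Omega u w + ip Omega v w.
Proof.
move=> u2 v2 w2; rewrite /ip mulr_sumr -big_split/=.
by apply: eq_bigr => i _; exact: ip0_lin.
Qed.

Lemma L2norm_sqr u : L2norm Omega u ^+ 2 = ip Omega u u.
Proof.
rewrite sqr_sqrtr// sumr_ge0// => i _.
by apply: Rintegral_ge0 => x _; rewrite -expr2 sqr_ge0.
Qed.

Lemma L2norm_comb (a b c : R) u v w :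
    L2_field u -> L2_field v -> L2_field w ->
  L2norm Omega (a *: u + b *: v + c *: w) ^+ 2 =
    a ^+ 2 * ip Omega u u + b ^+ 2 * ip Omega v v + c ^+ 2 * ip Omega w w
    + 2 * a * b * ip Omega u v + 2 * a * c * ip Omega u w
    + 2 * b * c * ip Omega v w.
Proof.
move=> u2 v2 w2; rewrite L2norm_sqr -addrA.
(* Writing c w = (c - 1) w + w lets the affine rules above scale one field. *)
have split_w : c *: w = (c - 1) *: w + w by rewrite scalerBl scale1r subrK.
have cw2 : L2_field (c *: w) by rewrite split_w; exact: L2_field_lin.
have cwE (s : vfield R) : L2_field s -> ip Omega (c *: w) s = c * ip Omega w s.
  by move=> s2; rewrite split_w ip_lin//; ring.
have bv2 : L2_field (b *: v + c *: w) by exact: L2_field_lin.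
have sum2 : L2_field (a *: u + (b *: v + c *: w)) by exact: L2_field_lin.
rewrite ip_lin// ip_lin// cwE//.
rewrite ![ip Omega _ (a *: u + _)]ipC !ip_lin// !cwE//.
rewrite (ipC v u) (ipC w u) (ipC w v); ring.
Qed.

Lemma spaceV_L2 u : spaceV Omega u -> L2_field u.
Proof. by case=> u1 _ i; have [[]] := u1 i. Qed.

Lemma DLN_scheme_L2 theta nu dt f (u : nat -> vfield R) :
  DLN_scheme theta Omega nu dt f u -> forall n, L2_field (u n).
Proof.
case=> u0 u1 step [|[|n]]; apply: spaceV_L2 => //.
by case: (step n.+1).
Qed.

End L2_expansion.

(** * Three-term combinations and block-diagonal matrices *)

Lemma comb3_nth (R : realType) (U : lmodType R) (a b c : R) (z : nat -> U) n :
  comb3 (nth 0 [:: a; b; c]) z n.+1 = c *: z n.+2 + b *: z n.+1 + a *: z n.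
Proof.
rewrite /comb3 !big_ord_recl big_ord0 /= addr0.
by rewrite addn0 addn1 addn2 addrC (addrC (b *: _)).
Qed.

Lemma posdef_block_diag (R : realType) (h1 h2 : R) :
  0 < h1 -> 0 < h2 -> posdefmx (block_diag h1 h2).
Proof.
move=> h1_gt0 h2_gt0; split.
  by rewrite /block_diag tr_block_mx !tr_scalar_mx !trmx0.
move=> x; rewrite -[x]vsubmxK; set y := usubmx x; set z := dsubmx x => yz0.
rewrite /block_diag tr_col_mx mul_row_block mul_row_col !mulmx0 addr0 add0r.
rewrite !mul_mx_scalar -!scalemxAl !mxE.
have sq (m : nat) (t : 'cV[R]_m) : \sum_i t^T 0 i * t i 0 = \sum_i t i 0 ^+ 2.
  by apply: eq_bigr => i _; rewrite mxE expr2.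
rewrite !sq.
have ge0 (m : nat) (t : 'cV[R]_m) : 0 <= \sum_i t i 0 ^+ 2.
  by apply: sumr_ge0 => i _; exact: sqr_ge0.
have gt0 (m : nat) (t : 'cV[R]_m) : t != 0 -> 0 < \sum_i t i 0 ^+ 2.
  move=> t0; rewrite lt0r ge0 andbT; apply: contraNneq t0 => S0.
  apply/eqP/matrixP => i j; rewrite ord1 mxE; apply/eqP.
  by rewrite -sqrf_eq0 (psumr_eq0P _ S0)// => k _; exact: sqr_ge0.
have [y0|/gt0 y_gt0] := eqVneq y 0; last first.
  by rewrite ltr_pwDl ?mulr_gt0// mulr_ge0// ltW.
have z0 : z != 0 by apply: contraNneq yz0 => z0; rewrite y0 z0 col_mx0.
by rewrite ltr_wpDl ?mulr_gt0 ?gt0// mulr_ge0// ltW.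
Qed.

(** * Matching the coefficients of the DLN quadratic form *)

Section DLN_algebra.
Variables (R : realType) (theta h : R).

(** Up to constant factors depending on theta, these are the coefficients of
the products NM, NO and MO on the left-hand side of the identity
([square_coefs] records the factors); n, m, o stand for new, mid and old. *)
Definition cross_nm : R := (1 - theta) - h * theta * (2 - theta).
Definition cross_no : R := theta + h * (4 - theta ^+ 2).
Definition cross_mo : R := (1 + theta) - h * theta * (2 + theta).

(** The coefficients of the square: solving 2ab, 2ac, 2bc for a, b, c produces
this common square root. *)
Definition sq_scale : R := Num.sqrt (cross_nm * cross_no * cross_mo / 8).
Definition sq_new : R := (1 + theta) * sq_scale / cross_mo.
Definition sq_mid : R := - (2 * theta * sq_scale / cross_no).
Definition sq_old : R := (1 - theta) * sq_scale / cross_nm.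

(** The coefficients of N^2, - M^2 and - O^2 left over on the left-hand side
when the square is removed. *)
Definition res_new : R :=
  (1 + theta) ^+ 2 / 8
  * ((2 - theta) * (1 + h * (2 - theta)) - cross_nm * cross_no / cross_mo).
Definition res_mid : R :=
  theta ^+ 2 / 2 * (theta * (1 - h * theta) + cross_nm * cross_mo / cross_no).
Definition res_old : R :=
  (1 - theta) ^+ 2 / 8
  * ((2 + theta) * (1 - h * (2 + theta)) + cross_no * cross_mo / cross_nm).

(** 1 + eps, the positive root of res_old g^2 + res_mid g = res_new. *)
Definition growth : R :=
  (Num.sqrt (res_mid ^+ 2 + 4 * res_old * res_new) - res_mid) / (2 * res_old).
(** h11; its companion h22 is [res_old]. *)
Definition wt_new : R := res_new / growth.

(** The two bounds on the time step, in terms of h = nu lam1 dt / 4. *)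
Definition admissible : Prop :=
  [/\ 0 < theta, theta < 1, 0 < h, 2 * h < 1 - theta &
      h * (8 - 6 * theta ^+ 2 + 3 * theta ^+ 4)
        < 2 * theta * (1 - theta ^+ 2)].

Hypothesis adm : admissible.

Lemma cross_nm_gt0 : 0 < cross_nm.
Proof.
have [t_gt0 t_lt1 h_gt0 h_lt1 h_lt2] := adm.
rewrite /cross_nm -mulrA.
have T0 : 0 < theta * (2 - theta) by rewrite mulr_gt0//; lra.
have hT : h * (theta * (2 - theta)) <= (1 - theta) / 2 * (theta * (2 - theta)).
  by apply: ler_wpM2r; lra.
have : 0 < (1 - theta) * (1 + (1 - theta) ^+ 2).
  by apply: mulr_gt0; have := sqr_ge0 (1 - theta); lra.
lra.
Qed.

Lemma cross_no_gt0 : 0 < cross_no.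
Proof.
have [t_gt0 t_lt1 h_gt0 h_lt1 h_lt2] := adm.
have : theta ^+ 2 <= 1 by rewrite expr_le1 ?ltW.
by rewrite /cross_no => ?; rewrite ltr_wpDr// mulr_ge0 ?ltW//; lra.
Qed.

Lemma cross_mo_gt0 : 0 < cross_mo.
Proof.
have [t_gt0 t_lt1 h_gt0 h_lt1 h_lt2] := adm.
rewrite /cross_mo -mulrA.
have T0 : 0 < theta * (2 + theta) by rewrite mulr_gt0//; lra.
have hT : h * (theta * (2 + theta)) <= (1 - theta) / 2 * (theta * (2 + theta)).
  by apply: ler_wpM2r; lra.
have : 0 < theta ^+ 2 * (1 + theta) by rewrite mulr_gt0 ?exprn_gt0//; lra.
lra.
Qed.

Let p_neq0 : cross_nm != 0. Proof. exact: lt0r_neq0 cross_nm_gt0. Qed.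
Let q_neq0 : cross_no != 0. Proof. exact: lt0r_neq0 cross_no_gt0. Qed.
Let r_neq0 : cross_mo != 0. Proof. exact: lt0r_neq0 cross_mo_gt0. Qed.

Lemma sq_scale_sqr : sq_scale ^+ 2 = cross_nm * cross_no * cross_mo / 8.
Proof.
by rewrite sqr_sqrtr// divr_ge0// !mulr_ge0// ltW//
  ?cross_nm_gt0 ?cross_no_gt0 ?cross_mo_gt0.
Qed.

Lemma square_coefs :
  [/\ sq_new ^+ 2 = (1 + theta) ^+ 2 / 8 * (cross_nm * cross_no / cross_mo),
      sq_mid ^+ 2 = theta ^+ 2 / 2 * (cross_nm * cross_mo / cross_no) &
      sq_old ^+ 2 = (1 - theta) ^+ 2 / 8 * (cross_no * cross_mo / cross_nm)] /\
  [/\ 2 * sq_new * sq_mid = - (theta * (1 + theta) / 2 * cross_nm),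
      2 * sq_new * sq_old = (1 - theta ^+ 2) / 4 * cross_no &
      2 * sq_mid * sq_old = - (theta * (1 - theta) / 2 * cross_mo)].
Proof.
have K x : x * (sq_scale ^+ 2) = x * (cross_nm * cross_no * cross_mo / 8).
  by rewrite sq_scale_sqr.
rewrite /sq_new /sq_mid /sq_old; split; split.
- transitivity (((1 + theta) / cross_mo) ^+ 2 * sq_scale ^+ 2); first by field.
  by rewrite K; field.
- transitivity ((2 * theta / cross_no) ^+ 2 * sq_scale ^+ 2); first by field.
  by rewrite K; field.
- transitivity (((1 - theta) / cross_nm) ^+ 2 * sq_scale ^+ 2); first by field.
  by rewrite K; field.
- transitivity ((- (4 * theta * (1 + theta)) / cross_mo / cross_no) * sq_scale ^+ 2).
    by field; rewrite q_neq0.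
  by rewrite K; field; rewrite q_neq0.
- transitivity ((2 * (1 - theta ^+ 2)) / cross_mo / cross_nm * sq_scale ^+ 2).
    by field; rewrite p_neq0.
  by rewrite K; field; rewrite p_neq0.
- transitivity ((- (4 * theta * (1 - theta)) / cross_no / cross_nm) * sq_scale ^+ 2).
    by field; rewrite p_neq0.
  by rewrite K; field; rewrite p_neq0.
Qed.

(** The value of the identity at N = M = O: the first three squares cancel and
the coefficients beta sum to 1, which leaves k / 2 = 2 h; the quotient is
(a + b + c)^2. *)
Lemma residual_gap :
  res_new - res_mid - res_old =
  2 * h - h ^+ 2 * (8 - 6 * theta ^+ 2 - 4 * h * theta * (4 - theta ^+ 2)) ^+ 2
          / (8 * cross_nm * cross_no * cross_mo).
Proof.
rewrite /res_new /res_mid /res_old.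
move: p_neq0 q_neq0 r_neq0; rewrite /cross_nm /cross_no /cross_mo => p0 q0 r0.
by field; rewrite p0 q0 r0.
Qed.

(** The inequality in x = theta^2 to which [square_defect] reduces once the step
h is eliminated with the help of h (8 - 6 x + 3 x^2) < 2 theta (1 - x). The
factor 9 / 10 is a convenient number below 1 for which it still holds. *)
Lemma margin_le (x : R) : 0 <= x <= 1 ->
  (8 - 6 * x) ^+ 2 * (8 - 6 * x + 3 * x ^+ 2) <=
  9 / 10 * 8 * (16 - 16 * x + 5 * x ^+ 2) * (8 - 14 * x + 7 * x ^+ 2).
Proof.
move=> x01; rewrite -subr_ge0.
(* In powers of 1 - x the quadratic part 5 - 24 y + 30 y^2 is positive. *)
set y := 1 - x; rewrite [leRHS](_ : _ =
  16 / 5 * (5 - 24 * y + 30 * y ^+ 2 + 72 * y ^+ 3 + 45 * y ^+ 4)); last first.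
  by rewrite /y; field.
have : 0 <= y ^+ 3 by apply: exprn_ge0; rewrite /y; lra.
have : 0 <= y ^+ 4 by apply: exprn_ge0; rewrite /y; lra.
nra.
Qed.

(** With M = 8 - 6 theta^2 - 4 h theta (4 - theta^2) and
D = 8 - 6 theta^2 + 3 theta^4, this says that
(a + b + c)^2 = h^2 M^2 / (8 cross_nm cross_no cross_mo) is at most 9 h / 5.
As M is bounded by its value at h = 0, it remains to bound the three factors
from below; the bound h D < 2 theta (1 - theta^2) does this for cross_nm *
cross_mo, and it bounds cross_no below by a multiple of h. *)
Lemma square_defect :
  h * (8 - 6 * theta ^+ 2 - 4 * h * theta * (4 - theta ^+ 2)) ^+ 2 <=
  72 / 5 * (cross_nm * cross_no * cross_mo).
Proof.
have [t_gt0 t_lt1 h_gt0 h_lt1 h_lt2] := adm.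
set x := theta ^+ 2; pose D := 8 - 6 * x + 3 * x ^+ 2.
have x01 : 0 < x < 1 by rewrite /x; nra.
have D_gt0 : 0 < D by rewrite /D; nra.
have hD : h * D < 2 * theta * (1 - x).
  by move: h_lt2; rewrite /D /x -exprM.
pose S := 8 - 14 * x + 7 * x ^+ 2.
have S_gt0 : 0 < S by rewrite /S; nra.
have prE : (1 - x) * S <= D * (cross_nm * cross_mo).
  rewrite (_ : cross_nm * cross_mo =
    (1 - x) - h * theta * (4 - 2 * x) + h ^+ 2 * x * (4 - x)); last first.
    by rewrite /cross_nm /cross_mo /x; ring.
  have : h * D * theta * (4 - 2 * x) <= 2 * x * (1 - x) * (4 - 2 * x).
    rewrite (_ : 2 * x * (1 - x) = 2 * theta * (1 - x) * theta); last first.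
      by rewrite /x; ring.
    by apply: ler_wpM2r; [lra|apply: ler_wpM2r; lra].
  have : 0 <= h ^+ 2 * x * (4 - x) * D by rewrite !mulr_ge0//; lra.
  by rewrite /S /D; lra.
have qE : h * (16 - 16 * x + 5 * x ^+ 2) <= 2 * (1 - x) * cross_no.
  by rewrite /cross_no -/x; move: hD; rewrite /D; lra.
set M := 8 - 6 * x - _.
have M2 : M ^+ 2 <= (8 - 6 * x) ^+ 2.
  rewrite ler_sqr ?nnegrE /M; last 2 first.
  - have : h * theta * (4 - x) <= (1 - theta) / 2 * theta * (4 - x).
      by apply: ler_wpM2r; [lra|apply: ler_wpM2r; lra].
    by rewrite /x; nra.
  - lra.
  by rewrite gerBl mulr_ge0//; nra.
have q_gt0 := cross_no_gt0.
have c_gt0 : 0 < 2 * (1 - x) * D by rewrite !mulr_gt0//; lra.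
rewrite -(ler_pM2l c_gt0).
apply: (@le_trans _ _
  (2 * h * (1 - x) * (9 / 10 * 8 * (16 - 16 * x + 5 * x ^+ 2) * S))).
  rewrite (_ : _ * (h * _) = 2 * h * (1 - x) * (M ^+ 2 * D)); last by ring.
  apply: ler_wpM2l; first by rewrite !mulr_ge0//; lra.
  apply: le_trans (margin_le _); last lra.
  by apply: ler_wpM2r => //; exact: ltW.
apply: (@le_trans _ _ (72 / 5 * (2 * (1 - x) * cross_no) * ((1 - x) * S))).
  rewrite (_ : 2 * h * (1 - x) * _ =
    72 / 5 * (h * (16 - 16 * x + 5 * x ^+ 2)) * ((1 - x) * S)); last by field.
  apply: ler_wpM2r; first by rewrite mulr_ge0//; lra.
  by apply: ler_wpM2l; lra.
rewrite (_ : 2 * _ * _ * (72 / 5 * _) =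
  72 / 5 * (2 * (1 - x) * cross_no) * (D * (cross_nm * cross_mo))); last by field.
apply: ler_wpM2l => //; rewrite !mulr_ge0//; lra.
Qed.

Lemma residual_gap_bounds : h / 5 <= res_new - res_mid - res_old <= 2 * h.
Proof.
have [t_gt0 t_lt1 h_gt0 h_lt1 h_lt2] := adm.
rewrite residual_gap; set M := 8 - _ - _.
have pqr : 0 < 8 * cross_nm * cross_no * cross_mo.
  by rewrite !mulr_gt0 ?cross_nm_gt0 ?cross_no_gt0 ?cross_mo_gt0.
have : h ^+ 2 * M ^+ 2 / (8 * cross_nm * cross_no * cross_mo) <= 9 / 5 * h.
  rewrite ler_pdivrMr// expr2 -mulrA [leRHS](_ : _ =
    h * (72 / 5 * (cross_nm * cross_no * cross_mo))); last by field.
  by apply: ler_wpM2l; [exact: ltW|exact: square_defect].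
have : 0 <= h ^+ 2 * M ^+ 2 / (8 * cross_nm * cross_no * cross_mo).
  by rewrite divr_ge0 ?(ltW pqr)// mulr_ge0 ?sqr_ge0.
lra.
Qed.

(** The bound is attained in the limit 2 h = 1 - theta with the term
cross_nm * cross_mo / cross_no discarded; likewise for [res_old_gt]. *)
Lemma res_mid_gt : theta ^+ 3 / 2 * (1 - theta * (1 - theta) / 2) < res_mid.
Proof.
have [t_gt0 t_lt1 h_gt0 h_lt1 h_lt2] := adm.
rewrite [ltLHS](_ : _ =
  theta ^+ 2 / 2 * (theta * (1 - theta * (1 - theta) / 2))); last by field.
rewrite ltr_pM2l ?divr_gt0 ?exprn_gt0//.
rewrite ltr_pwDr ?divr_gt0 ?mulr_gt0
  ?cross_nm_gt0 ?cross_no_gt0 ?cross_mo_gt0//.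
apply: ler_wpM2l; first exact: ltW.
have : h * theta <= (1 - theta) / 2 * theta by apply: ler_wpM2r; lra.
lra.
Qed.

Lemma res_old_gt :
  theta * (1 - theta) ^+ 2 * (1 + theta) * (2 + theta) / 16 < res_old.
Proof.
have [t_gt0 t_lt1 h_gt0 h_lt1 h_lt2] := adm.
rewrite [ltLHS](_ : _ =
  (1 - theta) ^+ 2 / 8 * ((2 + theta) * (theta * (1 + theta) / 2)));
  last by field.
rewrite ltr_pM2l ?divr_gt0 ?exprn_gt0 ?subr_gt0//.
rewrite ltr_pwDr ?divr_gt0 ?mulr_gt0
  ?cross_nm_gt0 ?cross_no_gt0 ?cross_mo_gt0//.
apply: ler_wpM2l; first lra.
have : h * (2 + theta) <= (1 - theta) / 2 * (2 + theta).
  by apply: ler_wpM2r; lra.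
lra.
Qed.

Lemma lower_bounds_gt0 :
  0 < theta ^+ 3 / 2 * (1 - theta * (1 - theta) / 2) /\
  0 < theta * (1 - theta) ^+ 2 * (1 + theta) * (2 + theta) / 16.
Proof.
have [t_gt0 t_lt1 h_gt0 h_lt1 h_lt2] := adm.
split; first (apply: mulr_gt0; first by rewrite divr_gt0 ?exprn_gt0).
  by nra.
by rewrite divr_gt0// !mulr_gt0 ?exprn_gt0//; lra.
Qed.

Lemma res_mid_gt0 : 0 < res_mid.
Proof. by have [L _] := lower_bounds_gt0; exact: lt_trans L res_mid_gt. Qed.

Lemma res_old_gt0 : 0 < res_old.
Proof. by have [_ L] := lower_bounds_gt0; exact: lt_trans L res_old_gt. Qed.

Lemma res_new_lt2 : res_new < 2.
Proof.
have [t_gt0 t_lt1 h_gt0 h_lt1 h_lt2] := adm.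
have pqr : 0 < cross_nm * cross_no / cross_mo.
  by rewrite divr_gt0 ?mulr_gt0 ?cross_nm_gt0 ?cross_no_gt0 ?cross_mo_gt0.
rewrite /res_new; set P := cross_nm * _ / _ in pqr *.
have t2 : (1 + theta) ^+ 2 <= 2 ^+ 2 by rewrite ler_sqr ?nnegrE; lra.
have hle1 : h * (2 - theta) <= 1 / 2 * 2 by apply: ler_pM; lra.
have hh : (2 - theta) * (1 + h * (2 - theta)) <= 2 * 2.
  have : 0 <= h * (2 - theta) by apply: mulr_ge0; lra.
  by move=> ?; apply: ler_pM; lra.
apply: (@lt_le_trans _ _ ((1 + theta) ^+ 2 / 8 * 4)); last by move: t2; lra.
rewrite ltr_pM2l ?divr_gt0 ?exprn_gt0//; lra.
Qed.

Lemma growth_root : res_old * growth ^+ 2 + res_mid * growth = res_new.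
Proof.
have [old_gt0 mid_gt0] := (res_old_gt0, res_mid_gt0).
have [t_gt0 t_lt1 h_gt0 h_lt1 h_lt2] := adm.
have /andP[gap _] := residual_gap_bounds.
have old_neq0 := lt0r_neq0 old_gt0.
rewrite /growth; set D := _ ^+ 2 + 4 * _ * _.
have D_ge0 : 0 <= D.
  by apply: addr_ge0; rewrite ?sqr_ge0//; apply: mulr_ge0; lra.
have := sqr_sqrtr D_ge0; set s := Num.sqrt D => s2.
transitivity ((s ^+ 2 - res_mid ^+ 2) / (4 * res_old)); first by field.
by rewrite s2 /D; field.
Qed.

(** Equivalently, the quadratic res_old g^2 + res_mid g - res_new is negative
at g = 1, which is the positivity of the gap. *)
Lemma growth_gt1 : 1 < growth.
Proof.
have [old_gt0 mid_gt0] := (res_old_gt0, res_mid_gt0).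
have [t_gt0 t_lt1 h_gt0 h_lt1 h_lt2] := adm.
have /andP[gap _] := residual_gap_bounds.
have incr : 0 < 4 * res_old * (res_new - res_mid - res_old).
  by apply: mulr_gt0; lra.
have dbl_gt0 : 0 < 2 * res_old by lra.
rewrite /growth (ltr_pdivlMr _ _ dbl_gt0) mul1r ltrBrDr.
have sum_ge0 : 0 <= 2 * res_old + res_mid by lra.
rewrite -(ger0_norm sum_ge0) -sqrtr_sqr ltr_sqrt; last first.
  by have := sqr_ge0 (2 * res_old + res_mid); lra.
lra.
Qed.

Lemma wt_newE : wt_new = res_old * growth + res_mid.
Proof.
have g_neq0 : growth != 0 by have := growth_gt1; lra.
by rewrite /wt_new -growth_root; field.
Qed.

(** The equation of the growth factor, minus its left-hand side at g = 1. *)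
Lemma growth_gap :
  (growth - 1) * (wt_new + res_old) = res_new - res_mid - res_old.
Proof. by rewrite wt_newE -growth_root; ring. Qed.

Lemma wt_new_gt : res_old + res_mid < wt_new.
Proof.
by rewrite wt_newE ltrD2r ltr_pMr ?res_old_gt0 ?growth_gt1.
Qed.

Lemma wt_new_lt2 : wt_new < 2.
Proof.
have [t_gt0 t_lt1 h_gt0 h_lt1 h_lt2] := adm.
have [g_gt1 X_lt2 mid_gt0 old_gt0] :=
  And4 growth_gt1 res_new_lt2 res_mid_gt0 res_old_gt0.
have /andP[gap _] := residual_gap_bounds.
apply: le_lt_trans X_lt2; rewrite /wt_new ler_pdivrMr; last lra.
by rewrite ler_peMr; lra.
Qed.

(** This makes eps < 4, since eps (h11 + h22) <= 2 h. The sum is at least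
2 res_old + res_mid, and the first bound on the step gives
h < 2 theta (1 - theta^2) / 5 because 8 - 6 theta^2 + 3 theta^4 >= 5. *)
Lemma weights_gt_step : h / 2 < wt_new + res_old.
Proof.
have [t_gt0 t_lt1 h_gt0 h_lt1 h_lt2] := adm.
have [old mid new] := And3 res_old_gt res_mid_gt wt_new_gt.
have step : h * 5 <= 2 * theta * (1 - theta ^+ 2).
  apply: le_trans (ltW h_lt2); apply: ler_wpM2l; first lra.
  have := sqr_ge0 (1 - theta ^+ 2); lra.
(* The three terms below add up, with positive factors, to the difference
   between the lower bound of the sum and theta (1 - theta^2) / 5. *)
have : 0 < theta * (2 - 5 * theta + 8 * theta ^+ 2).
  apply: mulr_gt0 => //; have := sqr_ge0 (16 * theta - 5); lra.
have : 0 <= theta ^+ 3 * (5 - 5 * theta).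
  by rewrite mulr_ge0 ?exprn_ge0//; lra.
have : 0 <= theta ^+ 5 by rewrite exprn_ge0//; lra.
lra.
Qed.

Lemma growth_bounds : h / 20 < growth - 1 < 4.
Proof.
have [t_gt0 t_lt1 h_gt0 h_lt1 h_lt2] := adm.
have [new_lt2 step mid_gt0 old_gt0] :=
  And4 wt_new_lt2 weights_gt_step res_mid_gt0 res_old_gt0.
have /andP[gap_ge gap_le] := residual_gap_bounds.
have new := wt_new_gt; have g := growth_gt1; have E := growth_gap.
apply/andP; split; rewrite ltNge; apply/negP => bad.
  have : (growth - 1) * (wt_new + res_old) < h / 20 * 4.
    apply: (@le_lt_trans _ _ (h / 20 * (wt_new + res_old))).
      by apply: ler_wpM2r; lra.
    by rewrite ltr_pM2l; lra.
  lra.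
have : 4 * (wt_new + res_old) <= (growth - 1) * (wt_new + res_old).
  by apply: ler_wpM2r; lra.
lra.
Qed.

Lemma DLN_a1_sqr : DLN_a1 theta ^+ 2 = theta * (1 - theta ^+ 2) / 2.
Proof.
have [t_gt0 t_lt1 h_gt0 h_lt1 h_lt2] := adm.
have t2_lt1 : theta ^+ 2 < 1 by rewrite expr_lt1// ltW.
rewrite sqrrN sqr_sqrtr// divr_ge0// mulr_ge0//; lra.
Qed.

(** The coefficient comparison: N, M, O stand for the squared norms and NM, NO,
MO for the inner products of the three velocities. *)
Lemma quadratic_form_split (N M O NM NO MO : R) :
  let d := DLN_a1 theta in
  let bn := (2 + theta - theta ^+ 2) / 4 in
  let bm := theta ^+ 2 / 2 in
  let bo := (2 - theta - theta ^+ 2) / 4 in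
  let sq x y z := x ^+ 2 * N + y ^+ 2 * M + z ^+ 2 * O
                  + 2 * x * y * NM + 2 * x * z * NO + 2 * y * z * MO in
  ((1 + theta) / 4 * N + (1 - theta) / 4 * M)
  - ((1 + theta) / 4 * M + (1 - theta) / 4 * O)
  + sq (- (d / 2)) d (- (d / 2)) + 2 * h * sq bn bm bo
  = growth * (wt_new * N + res_old * M) - (wt_new * M + res_old * O)
    + sq sq_new sq_mid sq_old.
Proof.
move=> d bn bm bo sq; have d2 := DLN_a1_sqr; rewrite -/d in d2.
have -> : sq (- (d / 2)) d (- (d / 2)) =
    d ^+ 2 * (N / 4 + M + O / 4 - NM + NO / 2 - MO) by rewrite /sq; field.
have [[a2 b2 c2] [ab ac bc]] := square_coefs.
rewrite d2 /sq a2 b2 c2 ab ac bc /bn /bm /bo.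
have newE : growth * wt_new = res_new.
  by rewrite /wt_new mulrC divfK//; have := growth_gt1; lra.
have -> : growth * (wt_new * N + res_old * M) - (wt_new * M + res_old * O) =
    res_new * N - res_mid * M - res_old * O.
  by rewrite mulrDr mulrA newE [X in _ - (X * M + _)]wt_newE; ring.
rewrite /res_new /res_mid /res_old.
move: p_neq0 q_neq0 r_neq0; rewrite /cross_nm /cross_no /cross_mo => p0 q0 r0.
by field; rewrite p0 q0 r0.
Qed.

(** The identity of the theorem for any quadratic functional Q in place of the
squared norm; NM, NO and MO are the values of its polar form. *)
Lemma DLN_energy_split (V : lmodType R) (Q : V -> R) (z : nat -> V) (n : nat)
    (NM NO MO : R) :
  (forall a b c : R, Q (a *: z n.+2 + b *: z n.+1 + c *: z n) =
     a ^+ 2 * Q (z n.+2) + b ^+ 2 * Q (z n.+1) + c ^+ 2 * Q (z n)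
     + 2 * a * b * NM + 2 * a * c * NO + 2 * b * c * MO) ->
  ((1 + theta) / 4 * Q (z n.+2) + (1 - theta) / 4 * Q (z n.+1))
  - ((1 + theta) / 4 * Q (z n.+1) + (1 - theta) / 4 * Q (z n))
  + Q (comb3 (DLN_a theta) z n.+1)
  + 2 * h * Q (comb3 (DLN_beta theta) z n.+1)
  = growth * (wt_new * Q (z n.+2) + res_old * Q (z n.+1))
    - (wt_new * Q (z n.+1) + res_old * Q (z n))
    + Q (sq_new *: z n.+2 + sq_mid *: z n.+1 + sq_old *: z n).
Proof.
move=> expand; rewrite /DLN_a /DLN_beta !comb3_nth !expand.
exact: quadratic_form_split.
Qed.

End DLN_algebra.

(** * The time step condition and the theorem *)

Lemma admissible_step (R : realType) (theta nu lam1 dt : R) :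
  0 < theta < 1 -> 0 < nu -> 0 < lam1 -> 0 < dt ->
  dt < (nu * lam1)^-1 *
       Num.min (8 * theta * (1 - theta ^+ 2)
                / (8 - 6 * theta ^+ 2 + 3 * theta ^+ 4))
               (2 * (1 - theta)) ->
  admissible theta (nu * lam1 * dt / 4).
Proof.
move=> /andP[t_gt0 t_lt1] nu_gt0 lam_gt0 dt_gt0.
have nl_gt0 : 0 < nu * lam1 by rewrite mulr_gt0.
rewrite mulrC ltr_pdivlMr// mulrC lt_min => /andP[].
have t2_lt1 : theta ^+ 2 < 1 by rewrite expr_lt1// ltW.
have t4_gt0 : 0 < theta ^+ 4 by rewrite exprn_gt0.
have den_gt0 : 0 < 8 - 6 * theta ^+ 2 + 3 * theta ^+ 4 by lra.
rewrite ltr_pdivlMr// => k_lt1 k_lt2.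
by split => //; [rewrite divr_gt0// mulr_gt0|lra|lra].
Qed.

Theorem lemma2p4 (R : realType) (theta : R) (htheta : 0 < theta < 1) :
  exists (C_h C_eps : R) (eps a b c h11 h22 : R -> R),
  [/\ 0 < C_h, 0 < C_eps &
  forall (Omega : set (R * R)) (nu lam1 dt : R) (f : R -> vfield R),
    domain Omega -> C2_boundary Omega ->
    0 < nu ->
    0 < lam1 -> smallest_stokes_eigenvalue Omega lam1 ->
    Linfty_H Omega f ->
    0 < dt ->
    dt < (nu * lam1)^-1 *
         Num.min (8 * theta * (1 - theta ^+ 2)
                  / (8 - 6 * theta ^+ 2 + 3 * theta ^+ 4))
                 (2 * (1 - theta)) ->
    let k := nu * lam1 * dt in
    [/\ 0 < eps k,
        posdefmx (block_diag (h11 k) (h22 k)),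
        forall u : nat -> vfield R, DLN_scheme theta Omega nu dt f u ->
          forall n : nat, (1 <= n)%N ->
          G_norm2 theta Omega (u n.+1) (u n)
          - G_norm2 theta Omega (u n) (u n.-1)
          + L2norm Omega (comb3 (DLN_a theta) u n) ^+ 2
          + nu * dt * lam1 / 2
            * L2norm Omega (comb3 (DLN_beta theta) u n) ^+ 2
          = (1 + eps k) * diag_norm2 Omega (h11 k) (h22 k) (u n.+1) (u n)
            - diag_norm2 Omega (h11 k) (h22 k) (u n) (u n.-1)
            + L2norm Omega (a k *: u n.+1 + b k *: u n + c k *: u n.-1) ^+ 2,
        0 < theta ^+ 3 / 2 * (1 - theta * (1 - theta) / 2) < h11 k
        /\ 0 < theta * (1 - theta) ^+ 2 * (1 + theta) * (2 + theta) / 16 < h22 k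
      & Num.max (h11 k) (h22 k) < C_h /\
        1 / 4 < (eps k)^-1 < C_eps / (nu * lam1 * dt)]].
Proof.
pose h k : R := k / 4.
exists 2, 80, (fun k => growth theta (h k) - 1), (fun k => sq_new theta (h k)),
  (fun k => sq_mid theta (h k)), (fun k => sq_old theta (h k)),
  (fun k => wt_new theta (h k)), (fun k => res_old theta (h k)).
split=> // Omega nu lam1 dt f _ _ nu_gt0 lam_gt0 _ _ dt_gt0 dt_lt k.
have adm : admissible theta (h k) by exact: admissible_step.
have [new_gt new_lt2] := (wt_new_gt adm, wt_new_lt2 adm).
have [old_gt mid_gt] := (res_old_gt adm, res_mid_gt adm).
have [lb_mid lb_old] := lower_bounds_gt0 adm.
have old_gt0 := res_old_gt0 adm.
have mid_gt0 := res_mid_gt0 adm.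
have /andP[eps_gt eps_lt] := growth_bounds adm.
have k_gt0 : 0 < k by rewrite !mulr_gt0.
have eps_gt0 : 0 < growth theta (h k) - 1 by move: eps_gt; rewrite /h; lra.
split=> //.
- by apply: posdef_block_diag => //; lra.
- move=> u /DLN_scheme_L2 u2 [//|n] _.
  have expand a b c :=
    L2norm_comb a b c (u2 n.+2) (u2 n.+1) (u2 n).
  rewrite /G_norm2 /diag_norm2 subrKC.
  rewrite (_ : nu * dt * lam1 / 2 = 2 * h k); last by rewrite /h /k; field.
  apply: (DLN_energy_split adm (Q := fun w => L2norm Omega w ^+ 2)) => a b c.
  rewrite expand -(L2norm_sqr _ (u n.+2)) -(L2norm_sqr _ (u n.+1)).
  by rewrite -(L2norm_sqr _ (u n)).
- by split; apply/andP; split=> //; lra.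
split; first by rewrite gt_max; apply/andP; split=> //; lra.
apply/andP; split.
  by rewrite div1r ltf_pV2 ?posrE.
rewrite -/k invf_plt ?posrE ?divr_gt0// invf_div.
by move: eps_gt; rewrite /h; lra.
Qed.
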